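(* Let $(A,B)$ be a pair of contractions acting on a Hilbert space $\mathcal{H}$ and let $Q\in\mathcal{B}(\mathcal{H})$ be a unitary such that any one of the following relations holds: \[AB=QBA,\qquad AB=BQA\qquad\text{or}\qquad AB=BAQ.\] Let $P=AB$ and let $QP=PQ$. If $P=P_1\oplus P_2$ is the canonical decomposition of $P$ with respect to the orthogonal decomposition $\mathcal{H}=\mathcal{H}_1\oplus\mathcal{H}_2$ (with $P_1=P|_{\mathcal{H}_1}$ unitary and $P_2=P|_{\mathcal{H}_2}$ c.n.u.), then the following hold: (1) $\mathcal{H}_1,\mathcal{H}_2$ are joint reducing subspaces for $A$, $B$ and $Q$; (2) $\mathcal{H}_1$ is the largest closed reducing subspace for $A,B$ such that both $A|_{\mathcal{H}_1}$ and $B|_{\mathcal{H}_1}$ are unitaries; (3) $(A|_{\mathcal{H}_2},B|_{\mathcal{H}_2})$ is a totally c.n.u. pair of contractions.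
   Context: All operators are bounded linear maps on complex Hilbert spaces; a contraction is an operator of norm at most $1$. A contraction $T$ is completely non-unitary (c.n.u.) if there is no nonzero closed subspace that reduces $T$ and on which $T$ acts as a unitary. Canonical decomposition: for a contraction $T$ on $\mathcal{H}$ there is a unique orthogonal decomposition $\mathcal{H}=\mathcal{H}_1\oplus\mathcal{H}_2$ into subspaces reducing $T$ (possibly zero) with $T|_{\mathcal{H}_1}$ unitary and $T|_{\mathcal{H}_2}$ c.n.u. A pair of contractions $(A,B)$ (not necessarily commuting) acting on a Hilbert space $\mathcal{K}$ is a totally c.n.u. pair if whenever a proper closed subspace $\mathcal{L}$ of $\mathcal{K}$ reduces both $A$ and $B$ to unitaries, then $\mathcal{L}=\{0\}$. *)

(* Defs.v *)
From HB Require Import structures.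
From mathcomp Require Import all_boot all_order all_algebra.
From mathcomp Require Export complex.
From mathcomp Require Import all_classical all_reals all_analysis.

Set Implicit Arguments.
Unset Strict Implicit.
Unset Printing Implicit Defensive.

Import Order.TTheory GRing.Theory Num.Theory.
Import numFieldNormedType.Exports.

Local Open Scope classical_set_scope.
Local Open Scope ring_scope.

(* The inner product is linear in its first argument and conjugate-linear in
   the second one. *)
HB.mixin Record CompleteNormedModule_isHilbert (R : realType) H
    of CompleteNormedModule R[i] H := {
  inner : {dot H for Num.conj};
  normE_inner : forall x : H, `|x| = sqrtC (inner x x)
}.

#[short(type="hilbertType")]
HB.structure Definition Hilbert (R : realType) :=
  {H of CompleteNormedModule_isHilbert R H & CompleteNormedModule R[i] H}.

Section operators.
Context {R : realType} {H : hilbertType R}.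
Implicit Types (K L : set H) (S T U A B P : H -> H).

Definition orthocompl L : set H := [set x | forall y, L y -> inner x y = 0].

Definition closed_subspace L := [/\ L 0,
  (forall (a : R[i]) (x y : H), L x -> L y -> L (a *: x + y)) & closed L].

(* An operator on a closed subspace K, viewed as a Hilbert space in its own
   right, is represented by a map on H leaving K invariant. The notions below
   depend only on the values of the map on K, so that the restriction of T to K
   is represented by T itself; K = setT gives the operators on H. *)
Definition invariant K T := forall x, K x -> K (T x).

Definition contraction_on K T :=
  invariant K T /\ forall x, K x -> `|T x| <= `|x|.

(* S is the adjoint of T on K; linearity and boundedness of S on K follow. *)
Definition adjoint_on K T S :=
  invariant K S /\ forall x y, K x -> K y -> inner (T x) y = inner x (S y).

(* U^* U = U U^* = 1 on K *)
Definition unitary_on K U := invariant K U /\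
  exists2 S, adjoint_on K U S & forall x, K x -> S (U x) = x /\ U (S x) = x.

(* L reduces T : K -> K when L and its orthocomplement in K are T-invariant. *)
Definition reduces_on K L T := [/\ closed_subspace L, L `<=` K,
  invariant L T & invariant (K `&` orthocompl L) T].

Definition cnu_on K T := contraction_on K T /\
  forall L, reduces_on K L T -> unitary_on L T -> L = [set 0].

Definition totally_cnu_pair_on K A B :=
  [/\ contraction_on K A, contraction_on K B &
      forall L, L `<` K -> reduces_on K L A -> reduces_on K L B ->
        unitary_on L A -> unitary_on L B -> L = [set 0]].

Definition orthogonal_decomposition (H1 H2 : set H) :=
  [/\ closed_subspace H1, closed_subspace H2,
      forall x y, H1 x -> H2 y -> inner x y = 0 &
      forall z, exists x y, [/\ H1 x, H2 y & z = x + y]].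

Definition canonical_decomposition P (H1 H2 : set H) :=
  [/\ orthogonal_decomposition H1 H2,
      reduces_on setT H1 P, reduces_on setT H2 P,
      unitary_on H1 P & cnu_on H2 P].

Definition reduces_to_unitaries A B L :=
  [/\ reduces_on setT L A, reduces_on setT L B,
      unitary_on L A & unitary_on L B].

End operators.

(* Main.v *)
(* Call N a core of T if T maps N isometrically onto N. For a contraction T the
   sum of two cores, and the closure of a linear core, are again cores, so the
   union M of all cores of P is a closed subspace; the part of M in H2 reduces
   P|H2 to a unitary, hence vanishes, and M = H1. Thus H1 contains every core
   of P, and likewise every core of QP or Q^*P, since translating such a core by
   all powers of Q yields a core of P. Each commutation relation amounts to
   BA = Q^*P, whence PA = A(Q^*P) and (Q^*P)B = BP, or to P = BQA, whence
   (QP)A = AP and PB = B(QP). As A and B are isometric on H1, both A(H1) and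
   B(H1) are then such cores, so they lie in H1. *)
Require Import Defs.
From mathcomp Require Import all_boot all_order all_algebra.
From mathcomp Require Import all_classical all_reals all_analysis.
From mathcomp Require Import ring.
Set Implicit Arguments.
Unset Strict Implicit.
Unset Printing Implicit Defensive.
Import Order.TTheory GRing.Theory Num.Theory.
Import numFieldNormedType.Exports.
Local Open Scope classical_set_scope.
Local Open Scope ring_scope.

Section isometry.
Context {R : realType} {H : hilbertType R}.
Implicit Types (K L M N : set H) (T : {linear H -> H}).

(** * Inner products and the vectors whose norm a contraction keeps *)

Lemma innerBl (x y z : H) : inner (x - y) z = inner x z - inner y z.
Proof. exact: linearBl. Qed.

Lemma innerBr (x y z : H) : inner x (y - z) = inner x y - inner x z.
Proof. exact: linearBr. Qed.

Lemma innerDl (x y z : H) : inner (x + y) z = inner x z + inner y z.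
Proof. exact: linearDl. Qed.

Lemma innerZl (a : R[i]) (x y : H) : inner (a *: x) y = a * inner x y.
Proof. exact: linearZl_LR. Qed.

Lemma innerZr (a : R[i]) (x y : H) : inner x (a *: y) = a^* * inner x y.
Proof. exact: linearZr_LR. Qed.

Lemma innerPr (a : R[i]) (x y z : H) :
  inner x (a *: y + z) = a^* * inner x y + inner x z.
Proof. exact: linearPr. Qed.

Lemma innerC (x y : H) : inner x y = (inner y x)^*.
Proof. by rewrite hermC /= expr0 mul1r. Qed.

Lemma inner_eq0C (x y : H) : inner x y = 0 -> inner y x = 0.
Proof. by rewrite innerC => /eqP; rewrite conjC_eq0 => /eqP. Qed.

Lemma sqr_norm_inner (x : H) : `|x| ^+ 2 = inner x x.
Proof. by rewrite normE_inner sqrtCK. Qed.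

Lemma contraction_inner T :
  contraction_on setT T -> forall x, inner (T x) (T x) <= inner x x.
Proof.
by move=> [_ hT] x; rewrite -!sqr_norm_inner lerXn2r ?nnegrE //; exact: hT.
Qed.

(* The form <z,w> - <Tz,Tw> is positive semidefinite, so by Cauchy-Schwarz a
   vector on which it vanishes lies in its kernel. *)
Lemma inner_contraction T (z w : H) : contraction_on setT T ->
  `|T w| = `|w| -> inner (T z) (T w) = inner z w.
Proof.
move=> hT hw; apply/eqP; rewrite eq_sym -subr_eq0; apply/eqP.
set c := (_ - _).
have qw : inner (T w) (T w) = inner w w by rewrite -!sqr_norm_inner hw.
have cC : c^* = inner w z - inner (T w) (T z).
  by rewrite rmorphB /= -!innerC.
pose q := inner z z - inner (T z) (T z).
have q0 : 0 <= q by rewrite subr_ge0 contraction_inner.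
(* Contractivity at [z - (t * c) *: w]: the terms quadratic in [t] cancel by [qw], leaving a bound
   affine in [t]. *)
have key (t : R[i]) : t^* = t -> 0 <= q - 2 * t * `|c| ^+ 2.
  move=> tr; have := contraction_inner hT (z - (t * c) *: w).
  have -> : T (z - (t * c) *: w) = T z - (t * c) *: T w.
    by rewrite linearB linearZ.
  rewrite -subr_ge0 !innerBl !innerBr !innerZl !innerZr rmorphM /= tr qw.
  by rewrite normCK cC /q /c; congr (0 <= _); ring.
apply/eqP; apply: contraT => c0.
have n0 : `|c| ^+ 2 != 0 by rewrite expf_eq0 /= normr_eq0.
(* This [t] turns the bound into [0 <= -1]; it is real, being nonnegative. *)
have := key ((q + 1) / (2 * `|c| ^+ 2)).
have -> : 2 * ((q + 1) / (2 * `|c| ^+ 2)) * `|c| ^+ 2 = q + 1.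
  by rewrite mulrAC mulrCA divff ?mulr1 // mulf_neq0 ?pnatr_eq0.
rewrite opprD addrA subrr add0r.
rewrite lerNr oppr0 ler10; apply; apply: conj_Creal; apply: ger0_real.
apply: divr_ge0; first exact: addr_ge0.
by apply: mulr_ge0 => //; exact: exprn_ge0.
Qed.

Lemma eq_norm_inner (x y : H) : `|x| = `|y| <-> inner x x = inner y y.
Proof.
split=> [e|e]; first by rewrite -!sqr_norm_inner e.
by rewrite !normE_inner e.
Qed.

(** Only the second argument of the inner product is expanded: [inner_contraction] allows any vector
    in the first. *)
Lemma isometric_linear T (a : R[i]) (u v : H) : contraction_on setT T ->
  `|T u| = `|u| -> `|T v| = `|v| -> `|T (a *: u + v)| = `|a *: u + v|.
Proof.
move=> hT hu hv; apply/eq_norm_inner.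
have E : T (a *: u + v) = a *: T u + T v by rewrite linearP.
by rewrite {2}E !innerPr !inner_contraction.
Qed.

Lemma contraction_continuous T : contraction_on setT T -> continuous T.
Proof.
move=> [_ hT]; apply: bounded_linear_continuous; apply/linear_boundedP.
near=> r => x; have r1 : 1 <= r by near: r; exact: nbhs_pinfty_ge.
by apply: (le_trans (hT x I)); rewrite ler_peMl.
Unshelve. all: by end_near. Qed.

(** * Cores and the operations preserving them *)

Definition isometric_core (T : H -> H) N :=
  forall y, N y -> [/\ N (T y), `|T y| = `|y| & exists2 z, N z & T z = y].

(** Taking both sets to be the union of all cores shows that this union is closed under linear
    combinations. *)
Lemma core_linear T (a : R[i]) M N : contraction_on setT T ->
  isometric_core T M -> isometric_core T N ->
  isometric_core T [set z | exists x y, [/\ M x, N y & z = a *: x + y]].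
Proof.
move=> hT hM hN _ [x [y [Mx Ny ->]]].
have [MTx nx [x' Mx' x'E]] := hM _ Mx.
have [NTy ny [y' Ny' y'E]] := hN _ Ny.
split; first by exists (T x), (T y); split=> //; rewrite linearP.
  exact: isometric_linear.
by exists (a *: x' + y'); [exists x', y'|rewrite linearP /= x'E y'E].
Qed.

(** Invariance and norms pass to the limit by continuity. For preimages, differences stay in [M] by
    linearity and keep their norm under [T], so preimages of a convergent filter form a Cauchy one,
    and completeness gives the limit. *)
Lemma core_closure T M : contraction_on setT T ->
  (forall (a : R[i]) x y, M x -> M y -> M (a *: x + y)) ->
  isometric_core T M -> isometric_core T (closure M).
Proof.
move=> hT lM hM y; rewrite closureEcvg => -[F PF [Fy MF]].
have FM : F M by apply: MF.
have cT := contraction_continuous hT.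
have TF : T @ F --> T y by apply: continuous_cvg => //; exact: cT.
split.
- exists (T @ F); first exact: fmap_proper_filter.
  split; first exact: TF.
  by move=> E ME; apply: MF => x Mx; apply: ME; have [] := hM _ Mx.
- apply: cvg_unique (cvg_norm TF) _; first exact: norm_hausdorff.
  apply: cvg_trans (cvg_norm Fy) => E /= FE.
  apply: (@filterS _ F _ (M `&` (fun x => `|x|) @^-1` E)); last first.
  exact: filterI.
  by move=> x [/hM[_ + _] Ex] => /= ->.
(* Chosen preimages; the default [0] off [M] is harmless because [F] contains [M]. *)
have /choice [S hS] : forall x, exists z, M x -> M z /\ T z = x.
  move=> x; have [/hM[_ _ [z Mz Tz]]|nMx] := pselect (M x); first by exists z.
  by exists 0.
have : cauchy (S @ F).
  apply: cauchy_exP => e e0.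
  have e20 : 0 < e / 2 by rewrite divr_gt0.
  have FB : F (M `&` ball y (e / 2)).
    by apply: filterI => //; apply: Fy; exact: nbhsx_ballx.
  have [y0 [My0 By0]] := filter_ex FB.
  exists (S y0); apply: (@filterS _ F _ _ _ _ FB) => x [Mx Bx] /=.
  have [MS TS] := hS _ Mx; have [MS0 TS0] := hS _ My0.
  have := lM (-1) _ _ MS MS0; rewrite scaleN1r addrC => /hM[_ hn _].
  rewrite -ball_normE /= -hn linearB /= TS TS0.
  by have := ball_splitr By0 Bx; rewrite -ball_normE.
move=> /cauchy_cvgP/cvg_ex[z Sz].
exists z.
  exists (S @ F); first exact: fmap_proper_filter.
  split; first exact: Sz.
  move=> E ME; apply: (@filterS _ F _ M) => // x Mx.
  by apply: ME; have [] := hS _ Mx.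
have TSz : T \o S @ F --> T z by apply: continuous_cvg => //; exact: cT.
apply: cvg_unique TSz _; first exact: norm_hausdorff.
apply: cvg_trans Fy => E; rewrite /fmap /= => FE.
apply: (@filterS _ F _ (M `&` E)); last exact: filterI.
by move=> x [/hS[_ /= ->]].
Qed.

Lemma unitary_core T K : unitary_on K T -> isometric_core T K.
Proof.
move=> [iT [S [iS adj] ST]] y Ky; have [STy TSy] := ST _ Ky; split.
- exact: iT.
- by apply/eq_norm_inner; rewrite adj ?STy//; exact: iT.
- by exists (S y) => //; exact: iS.
Qed.

(** Each element of [L] is some [T z] with [z] in [L], and [inner (T x) (T z) = inner x z] for every
    [x]. Hence [T] preserves orthogonality to [L], and a right inverse of [T] on [L] is its
    adjoint. *)
Lemma core_reduces T K L : contraction_on setT T -> Defs.invariant K T ->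
  closed_subspace L -> L `<=` K -> isometric_core T L ->
  reduces_on K L T /\ unitary_on L T.
Proof.
move=> hT iK cL LK hL; have iL : Defs.invariant L T by move=> x /hL[].
have iso x y : L y -> inner (T x) (T y) = inner x y.
  by move=> /hL[_ ny _]; exact: inner_contraction.
split.
  split=> // x [Kx xL]; split; first exact: iK.
  by move=> _ /hL[_ _ [z Lz <-]]; rewrite iso//; exact: xL.
have /choice[S hS] : forall y, exists z, L y -> L z /\ T z = y.
  move=> y; have [/hL[_ _ [z Lz Tz]]|nLy] := pselect (L y); first by exists z.
  by exists 0.
split=> //; exists S.
  split=> [x /hS[]//|x y Lx /hS[LSy TSy]].
  by rewrite -{1}TSy iso.
move=> x Lx; have [LSx TSx] := hS _ Lx; split=> //.
(* [S] is also a left inverse: [T] kills [S (T x) - x] but keeps its norm. *)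
have [LSTx TSTx] := hS _ (iL _ Lx).
have [_ lL _] := cL; have := lL (-1) _ _ Lx LSTx; rewrite scaleN1r => /hL[_].
rewrite linearD linearN /= TSTx addNr normr0 => /esym/eqP.
by rewrite normr_eq0 addrC subr_eq0 => /eqP.
Qed.

Lemma core_comp (S T : H -> H) K :
  isometric_core S K -> isometric_core T K -> isometric_core (S \o T) K.
Proof.
move=> hS hT y Ky; have [KT nT _] := hT _ Ky; have [KST nST _] := hS _ KT.
split; rewrite /= ?nST//.
have [_ _ [z Kz <-]] := hS _ Ky; have [_ _ [w Kw <-]] := hT _ Kz.
by exists w.
Qed.

(** The intertwining [S T = T W] transports invariance, norms and preimages from [W] to [S]. *)
Lemma core_image (S T W : H -> H) K : isometric_core W K ->
  (forall x, K x -> `|T x| = `|x|) -> (forall x, K x -> S (T x) = T (W x)) ->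
  isometric_core S (T @` K).
Proof.
move=> hW nT ST _ [x Kx <-]; have [KW nW [z Kz Wz]] := hW _ Kx.
split; rewrite ?ST//.
- by rewrite !nT.
- by exists (T z); [exists z|rewrite ST// Wz].
Qed.

(* The set below is the union of the translates of N under the group
   generated by Q. *)
Lemma core_twist (Q Q' P : H -> H) N : (forall x, `|Q x| = `|x|) ->
  cancel Q Q' -> cancel Q' Q -> (forall x, Q (P x) = P (Q x)) ->
  isometric_core (Q \o P) N ->
  isometric_core P
    [set y | exists i j x, N x /\ y = iter i Q (iter j Q' x)].
Proof.
move=> nQ QK Q'K QP hN.
have nQ' x : `|Q' x| = `|x| by rewrite -nQ Q'K.
have Q'P x : Q' (P x) = P (Q' x) by rewrite -[RHS]QK QP Q'K.
have Pi i x : P (iter i Q x) = iter i Q (P x).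
  by elim: i => //= i IH; rewrite -QP IH.
have Pj j x : P (iter j Q' x) = iter j Q' (P x).
  by elim: j => //= j IH; rewrite -Q'P IH.
have ni i x : `|iter i Q x| = `|x| by elim: i => //= i IH; rewrite nQ.
have nj j x : `|iter j Q' x| = `|x| by elim: j => //= j IH; rewrite nQ'.
move=> _ [i [j [x [Nx ->]]]]; have [NQP nQP [z Nz QPz]] := hN _ Nx.
(* Inserting [Q' Q] replaces [P x], which need not lie in [N], by [Q (P x)], which does; hence
   [j.+1]. *)
have PE : P (iter i Q (iter j Q' x)) = iter i Q (iter j.+1 Q' (Q (P x))).
  by rewrite Pi Pj iterSr QK.
split.
- by exists i, j.+1, (Q (P x)).
- by rewrite Pi Pj !ni !nj -[LHS]nQ.
(* Since [x = Q (P z)], the preimage needs one more factor [Q]. *)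
- exists (iter i.+1 Q (iter j Q' z)); first by exists i.+1, j, z.
  rewrite Pi Pj iterSr; congr iter.
  rewrite -[in RHS]QPz /=; elim: j {PE} => //= j <-.
  by rewrite QK Q'K.
Qed.

(** * Orthogonal decompositions *)

Lemma ortho_decomp_disjoint (H1 H2 : set H) :
  orthogonal_decomposition H1 H2 -> forall x, H1 x -> H2 x -> x = 0.
Proof.
move=> [_ _ o _] x x1 x2; apply/eqP.
by rewrite -normr_eq0 -sqrf_eq0 sqr_norm_inner o.
Qed.

Lemma ortho_decomp_compl (H1 H2 : set H) :
  orthogonal_decomposition H1 H2 -> orthocompl H1 = H2.
Proof.
move=> D; have [_ _ o s] := D; apply/seteqP; split=> x.
  move=> hx; have [x1 [x2 [h1 h2 xE]]] := s x.
  have : inner x x1 = 0 by exact: hx.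
  rewrite {1}xE innerDl (inner_eq0C (o _ _ h1 h2)) addr0 -sqr_norm_inner.
  by move=> /eqP; rewrite sqrf_eq0 normr_eq0 xE => /eqP->; rewrite add0r.
by move=> x2 y y1; apply: inner_eq0C; exact: o.
Qed.

Lemma ortho_decomp_reduces T (H1 H2 : set H) :
  orthogonal_decomposition H1 H2 ->
  reduces_on setT H1 T -> reduces_on setT H2 T.
Proof.
move=> D; have [c1 c2 o s] := D; move=> [_ _ i1 i2].
have D' : orthogonal_decomposition H2 H1.
  split=> // [x y x2 y1|z]; first by apply: inner_eq0C; exact: o.
  by have [x [y [x1 y2 ->]]] := s z; exists y, x; split=> //; rewrite addrC.
split=> //; rewrite ?(ortho_decomp_compl D') ?setTI//.
by move: i2; rewrite (ortho_decomp_compl D) setTI.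
Qed.

(** * Cores and the canonical decomposition *)

Lemma core_sub_unitary_part (P : {linear H -> H}) (H1 H2 N : set H) :
  contraction_on setT P ->
  canonical_decomposition P H1 H2 -> isometric_core P N -> N `<=` H1.
Proof.
move=> hP [D _ [_ _ iH2 _] u1 [_ cnu]] hN.
have hH1 := unitary_core u1.
have [[H10 _ _] [H20 lH2 cH2] _ s] := D.
pose M := [set x | exists2 N, isometric_core P N & N x].
have subM K : isometric_core P K -> K `<=` M by move=> hK x Kx; exists K.
(* Cores need not be linear, so a union of cores is a core at once. *)
have hM : isometric_core P M.
  move=> y [K hK Ky]; have [KP nP [z Kz Pz]] := hK _ Ky.
  by split=> //; [exists K|exists z => //; exists K].
have lM (a : R[i]) x y : M x -> M y -> M (a *: x + y).
  move=> Mx My; apply: subM (core_linear hP hM hM) _ _.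
  by exists x, y.
have cM : closed M.
  apply/closure_id/seteqP; split; first exact: subset_closure.
  by apply: subM; exact: core_closure.
have MH2 : isometric_core P (M `&` H2).
  move=> y [My H2y]; have [MP nP [z Mz Pz]] := hM _ My.
  split=> //; first by split=> //; exact: iH2.
  exists z => //; split=> //.
  (* The preimage must lie in [H2]: [P z1 = y - P z2] is in both [H1] and [H2], so it vanishes, and
     [z1] has the same norm. *)
  have [z1 [z2 [h1 h2 zE]]] := s z.
  have [H1P n1 _] := hH1 _ h1.
  suff z10 : z1 = 0 by rewrite zE z10 add0r.
  apply/eqP; rewrite -normr_eq0 -n1 normr_eq0; apply/eqP.
  apply: (ortho_decomp_disjoint D) => //.
  have -> : P z1 = -1 *: P z2 + y.
    by rewrite -Pz zE linearD scaleN1r addrC /= addrK.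
  by apply: lH2 => //; exact: iH2.
have cMH2 : closed_subspace (M `&` H2).
  split; last exact: closedI.
    by split=> //; apply: (subM _ hH1).
  by move=> a x y [Mx H2x] [My H2y]; split; [exact: lM|exact: lH2].
have [red uni] := core_reduces hP iH2 cMH2 (@subIsetr _ _ _) MH2.
move=> x Nx; have [x1 [x2 [h1 h2 xE]]] := s x.
(* [M] contains [H1] and [x], hence [x2 = x - x1], which the c.n.u. property forces to be [0]. *)
suff : (M `&` H2) x2 by rewrite (cnu _ red uni) xE => ->; rewrite addr0.
split=> //; have -> : x2 = -1 *: x1 + x by rewrite xE scaleN1r addKr.
by apply: lM; [exact: (subM _ hH1)|exact: (subM _ hN)].
Qed.

End isometry.

Theorem theorem6p9 (R : realType) (H : hilbertType R)
  (A B Q P : {linear H -> H}) (H1 H2 : set H)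
  (hA : contraction_on setT A) (hB : contraction_on setT B)
  (hQ : unitary_on setT Q)
  (hAB : [\/ (forall x, A (B x) = Q (B (A x))),
             (forall x, A (B x) = B (Q (A x))) |
             (forall x, A (B x) = B (A (Q x)))])
  (hP : forall x, P x = A (B x))
  (hQP : forall x, Q (P x) = P (Q x))
  (hH : canonical_decomposition P H1 H2) :
  [/\ [/\ reduces_on setT H1 A, reduces_on setT H1 B & reduces_on setT H1 Q]
      /\ [/\ reduces_on setT H2 A, reduces_on setT H2 B & reduces_on setT H2 Q],
      reduces_to_unitaries A B H1 /\
      (forall L : set H, reduces_to_unitaries A B L -> L `<=` H1) &
      totally_cnu_pair_on H2 A B].

Proof.
have nA x : `|A x| <= `|x| by case: hA => _; exact.
have nB x : `|B x| <= `|x| by case: hB => _; exact.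
have cP : contraction_on setT P.
  by split=> // x _; rewrite hP; exact: le_trans (nA _) (nB _).
have [_ [Q' [_ adjQ] QQ']] := hQ.
have QK : cancel Q Q' by move=> x; have [] := QQ' x I.
have Q'K : cancel Q' Q by move=> x; have [] := QQ' x I.
have nQ x : `|Q x| = `|x| by apply/eq_norm_inner; rewrite adjQ// QK.
have nQ' x : `|Q' x| = `|x| by rewrite -nQ Q'K.
have Q'P x : Q' (P x) = P (Q' x) by rewrite -[RHS]QK hQP Q'K.
have cQ : contraction_on setT Q by split=> // x _; rewrite nQ.
have [D _ _ uP _] := hH; have [c1 _ _ _] := D.
have kP := unitary_core uP.
have sub N : isometric_core P N -> N `<=` H1.
  by exact: core_sub_unitary_part cP hH.
have QH1 x : H1 x -> H1 (Q x).
  move=> x1; have PQ y (_ : H1 y) := esym (hQP y).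
  apply: (sub _ (core_image kP (fun y _ => nQ y) PQ)).
  by exists x.
have Q'H1 x : H1 x -> H1 (Q' x).
  move=> x1; have PQ' y (_ : H1 y) := esym (Q'P y).
  apply: (sub _ (core_image kP (fun y _ => nQ' y) PQ')).
  by exists x.
have kQ : isometric_core Q H1.
  move=> x x1; split; [exact: QH1|exact: nQ|].
  by exists (Q' x); [exact: Q'H1|exact: Q'K].
have kQ' : isometric_core Q' H1.
  move=> x x1; split; [exact: Q'H1|exact: nQ'|].
  by exists (Q x); [exact: QH1|exact: QK].
have subQ N : isometric_core (Q \o P) N -> N `<=` H1.
  move=> hN x Nx; apply: (sub _ (core_twist nQ QK Q'K hQP hN)).
  (* Zero exponents: [N] is one of its own translates. *)
  by exists 0, 0, x.
have subQ' N : isometric_core (Q' \o P) N -> N `<=` H1.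
  move=> hN x Nx; apply: (sub _ (core_twist nQ' Q'K QK Q'P hN)).
  by exists 0, 0, x.
(* Squeeze: [|x| = |A (B x)| <= |B x| <= |x|]. *)
have nBH1 x : H1 x -> `|B x| = `|x|.
  move=> /kP[_ nP _]; apply/le_anti; rewrite nB /=.
  by rewrite -nP hP; exact: nA.
have [kA kB] : isometric_core A H1 /\ isometric_core B H1.
  (* The third relation joins the first, as [Q'] commutes with [P]. *)
  have BA_or : (forall x, B (A x) = Q' (P x)) \/ (forall x, P x = B (Q (A x))).
    case: hAB => e; [left=> x|right=> x|left=> x].
    - by rewrite hP e QK.
    - by rewrite hP e.
    - by rewrite Q'P hP e Q'K.
  have nAH1 x : H1 x -> `|A x| = `|x|.
    move=> /kP[_ nP _]; apply/le_anti; rewrite nA /=.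
    case: BA_or => e; rewrite -nP.
      by rewrite -nQ' -e nB.
    by rewrite e (le_trans (nB _))// nQ.
  have AH1 x : H1 x -> H1 (A x).
    case: BA_or => e x1.
      apply: (sub _ (core_image (T := A) (core_comp kQ' kP) nAH1 _)).
        by move=> y _; rewrite /= -e hP.
      by exists x.
    (* Here [Q P A = P Q A = A (B Q A) = A P]. *)
    apply: (subQ _ (core_image (T := A) kP nAH1 _)).
      by move=> y _; rewrite /= hQP hP -e.
    by exists x.
  have BH1 x : H1 x -> H1 (B x).
    case: BA_or => e x1.
      apply: (subQ' _ (core_image (T := B) kP nBH1 _)).
        by move=> y _; rewrite /= -e hP.
      by exists x.
    apply: (sub _ (core_image (T := B) (core_comp kQ kP) nBH1 _)).
      by move=> y _; rewrite /= e hP.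
    by exists x.
  split=> x x1; split; rewrite ?nAH1 ?nBH1//; try by [exact: AH1|exact: BH1].
    have [_ _ [z z1 <-]] := kP _ x1; exists (B z) => //; exact: BH1.
  (* Preimages under [B] come from writing [x] as [Q' (P z) = B (A z)], or as
     [P z = B (Q (A z))]. *)
  case: BA_or => e.
    have [_ _ [z z1 <-]] := core_comp kQ' kP x1.
    by exists (A z); [exact: AH1|rewrite e].
  have [_ _ [z z1 <-]] := kP _ x1.
  by exists (Q (A z)); [exact/QH1/AH1|rewrite e].
have [rA uA] : reduces_on setT H1 A /\ unitary_on H1 A.
  exact: core_reduces hA _ c1 _ kA.
have [rB uB] : reduces_on setT H1 B /\ unitary_on H1 B.
  exact: core_reduces hB _ c1 _ kB.
have [rQ _] : reduces_on setT H1 Q /\ unitary_on H1 Q.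
  exact: core_reduces cQ _ c1 _ kQ.
(* Such an [L] is a core of both factors, hence of [P]. *)
have largest L : unitary_on L A -> unitary_on L B -> L `<=` H1.
  move=> /unitary_core lA /unitary_core lB; apply: sub.
  move=> x Lx; have := core_comp lA lB Lx; rewrite /= -hP => -[? ? [z Lz]] /= e.
  by split=> //; exists z; rewrite ?hP.
have rA2 := ortho_decomp_reduces D rA.
have rB2 := ortho_decomp_reduces D rB.
split.
- by split; split=> //; exact: ortho_decomp_reduces D rQ.
- by split=> // L [_ _ lA lB]; exact: largest.
- have [_ _ iA _] := rA2; have [_ _ iB _] := rB2.
  split; [by split|by split|].
  move=> L [LH2 _] [[L0 _ _] _ _ _] _ lA lB.
  apply/seteqP; split=> x /= => [Lx|->//].
  by apply: (ortho_decomp_disjoint D); [exact: largest lA lB _ Lx|exact: LH2].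
Qed.
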